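(* Let $n\ge 1$ be an integer, let $R_{A_n}=\mathbb{C}[s,st,st^2,\dots,st^n]$ be the ring of the rational normal curve of degree $n$, and let $J=P_1\cap P_2$, where $P_1=\langle st,st^2,\dots,st^n\rangle$ and $P_2=\langle s,st,\dots,st^{n-1}\rangle$ are the prime ideals of $R_{A_n}$ associated to the two facets. (Thus $J=\langle st,st^2,\dots,st^{n-1}\rangle$ if $n>1$ and $J=\langle s^2t\rangle$ if $n=1$.) Then $$J\,D(R_{A_n}) = D(R_{A_n},J)\quad\text{if } n\in\{1,2\},\qquad\text{and}\qquad J\,D(R_{A_n})\neq D(R_{A_n},J)\quad\text{for every } n\ge 3.$$
   Context: For a finitely generated commutative $\mathbb{C}$-algebra $R$, $D(R)$ denotes the ring of ($\mathbb{C}$-linear, Grothendieck) differential operators on $R$, and $\delta\ast f$ denotes the action of $\delta\in D(R)$ on $f\in R$. The ring $R_{A_n}$ is the subring $\mathbb{C}[s,st,\dots,st^n]$ of the Laurent polynomial ring $\mathbb{C}[s^{\pm1},t^{\pm1}]$, i.e. the semigroup ring $\mathbb{C}[\mathbb{N}A_n]$ of the semigroup $\mathbb{N}A_n\subset\mathbb{Z}^2$ generated by the columns $(1,0),(1,1),\dots,(1,n)$. Its ring of differential operators is identified with $\{\delta\in D(\mathbb{C}[s^{\pm1},t^{\pm1}]) \mid \delta\ast R_{A_n}\subseteq R_{A_n}\}$. For an ideal $J$ of $R$, $D(R,J):=\{\delta\in D(R)\mid \delta\ast R\subseteq J\}$, and $J\,D(R)$ denotes the right ideal of $D(R)$ generated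 by $J$, where elements of $J$ are viewed as multiplication operators. *)

(* Defs.v *)
From HB Require Import structures.
From mathcomp Require Import all_boot all_order all_algebra.
From mathcomp Require Import finmap.
From mathcomp Require Import boolp classical_sets reals.
From mathcomp Require Import complex.
From mathcomp Require Import monalg.

Set Implicit Arguments.
Unset Strict Implicit.
Unset Printing Implicit Defensive.

Import GRing.Theory.

Local Open Scope classical_set_scope.
Local Open Scope ring_scope.

Section CommutativeAlgebra.
Variables (K : comNzRingType) (A : comAlgType K).

Definition ideal_gen (G : set A) : set A :=
  [set x | exists (m : nat) (r g : 'I_m -> A),
     (forall i, G (g i)) /\ x = \sum_i r i * g i].

Definition commutator (d : A -> A) (f : A) : A -> A :=
  fun x => d (f * x) - f * d x.

(* Grothendieck differential operators of order at most m *)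
Fixpoint diffop_ord (m : nat) (d : A -> A) : Prop :=
  linear d /\
  forall f : A,
    if m is m'.+1 then diffop_ord m' (commutator d f)
    else forall x, commutator d f x = 0.

Definition diffop : set (A -> A) := [set d | exists m, diffop_ord m d].

(* D(A, J) *)
Definition diffop_into (J : set A) : set (A -> A) :=
  [set d | diffop d /\ forall f, J (d f)].

(* J D(A): the finite sums of products j d with j in J and d in D(A) *)
Definition ideal_diffop (J : set A) : set (A -> A) :=
  [set d | exists (m : nat) (j : 'I_m -> A) (e : 'I_m -> A -> A),
     [/\ forall i, J (j i), forall i, diffop (e i)
       & d = (fun x => \sum_i j i * e i x)]].

End CommutativeAlgebra.

(* K[s^{+-1}, t^{+-1}] as the group algebra of Z^2. The product of monalg is
   not available here: it requires a monoid of exponents without non-trivial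
   invertible elements. *)
Definition laurent (K : comNzRingType) : Type := {malg K[(int * int)%type]}.

HB.instance Definition _ (K : comNzRingType) := GRing.Lmodule.on (laurent K).

(* c s^(k.1) t^(k.2) *)
HB.lock Definition lmon (K : comNzRingType) (c : K) (k : int * int)
  : laurent K := mkmalgU k c.

HB.lock Definition lmul (K : comNzRingType) (g h : laurent K) : laurent K :=
  \sum_(k <- msupp g) \sum_(l <- msupp h) lmon (g@_k * h@_l) (k + l).

Section Laurent.
Variable K : comNzRingType.
Implicit Types (g h : laurent K) (c d : K) (k l : int * int).

Lemma lcoefU c k l : (lmon c k)@_l = c *+ (k == l).
Proof. by rewrite lmon.unlock mcoeffU. Qed.

Lemma lcoefUU c k : (lmon c k)@_k = c.
Proof. by rewrite lcoefU eqxx. Qed.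

Lemma lmon0 k : lmon 0 k = 0 :> laurent K.
Proof. by rewrite lmon.unlock monalgU0. Qed.

Lemma lmonD c d k : lmon (c + d) k = lmon c k + lmon d k.
Proof. by rewrite lmon.unlock monalgUD. Qed.

Lemma lmonZ c d k : c *: lmon d k = lmon (c * d) k.
Proof. by apply/malgP => l; rewrite mcoeffZ !lcoefU mulrnAr. Qed.

Lemma msupp_lmon c k : (msupp (lmon c k) `<=` [fset k])%fset.
Proof. by rewrite lmon.unlock msuppU_le. Qed.

Lemma laurentE g : g = \sum_(k <- msupp g) lmon g@_k k.
Proof.
by rewrite [LHS]monalgE; apply: eq_bigr => k _; rewrite lmon.unlock.
Qed.

Lemma lmulwl g h (D : {fset int * int}) : (msupp g `<=` D)%fset ->
  lmul g h = \sum_(k <- D) \sum_(l <- msupp h) lmon (g@_k * h@_l) (k + l).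
Proof.
move=> gD; rewrite lmul.unlock (big_fset_incl _ gD) // => k _ /mcoeff_outdom ->.
by rewrite big1 // => l _; rewrite mul0r lmon0.
Qed.

Lemma lmulC : commutative (@lmul K).
Proof.
move=> g h; rewrite lmul.unlock exchange_big; apply: eq_bigr => l _ /=.
by apply: eq_bigr => k _; rewrite mulrC addrC.
Qed.

Lemma lmulDl : left_distributive (@lmul K) +%R.
Proof.
move=> g1 g2 h.
set D := (msupp g1 `|` msupp g2)%fset.
rewrite (@lmulwl (g1 + g2) h D); last exact: msuppD_le.
rewrite (@lmulwl g1 h D) ?fsubsetUl // (@lmulwl g2 h D) ?fsubsetUr //.
rewrite -big_split; apply: eq_bigr => k _ /=.
rewrite -big_split; apply: eq_bigr => l _ /=.
by rewrite mcoeffD mulrDl lmonD.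
Qed.

Lemma lmulDr : right_distributive (@lmul K) +%R.
Proof. by move=> g h1 h2; rewrite lmulC lmulDl !(lmulC _ g). Qed.

Lemma lmulUU c d k l : lmul (lmon c k) (lmon d l) = lmon (c * d) (k + l).
Proof.
rewrite (lmulwl _ (msupp_lmon c k)) big_seq_fset1 lcoefUU.
rewrite (big_fset_incl _ (msupp_lmon d l)) ?big_seq_fset1 ?lcoefUU // => m _.
by move=> /mcoeff_outdom ->; rewrite mulr0 lmon0.
Qed.

Lemma lmul0l g : lmul 0 g = 0.
Proof. by apply: (addIr (lmul 0 g)); rewrite -lmulDl !add0r. Qed.

Lemma lmul0r g : lmul g 0 = 0.
Proof. by rewrite lmulC lmul0l. Qed.

Lemma laurent_ind (P : laurent K -> Prop) :
  P 0 -> (forall g h, P g -> P h -> P (g + h)) ->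
  (forall c k, P (lmon c k)) -> forall g, P g.
Proof.
move=> P0 PD PU g; rewrite (laurentE g).
by apply: big_ind => // k _; apply: PU.
Qed.

Lemma lmulA : associative (@lmul K).
Proof.
move=> f g h; elim/laurent_ind: f => [|f1 f2 E1 E2|c k].
- by rewrite !lmul0l.
- by rewrite (lmulDl f1) E1 E2 -lmulDl -lmulDl.
elim/laurent_ind: g => [|g1 g2 E1 E2|d l].
- by rewrite lmul0l lmul0r lmul0l.
- by rewrite (lmulDl g1) (lmulDr _ g1) (lmulDl (lmul _ g1)) lmulDr E1 E2.
elim/laurent_ind: h => [|h1 h2 E1 E2|e m].
- by rewrite !lmul0r.
- by rewrite (lmulDr _ h1 h2) lmulDr (lmulDr _ h1 h2) E1 E2.
- by rewrite !lmulUU mulrA addrA.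
Qed.

Lemma lmul1l : left_id (lmon 1 0) (@lmul K).
Proof.
move=> g; elim/laurent_ind: g => [|g1 g2 E1 E2|c k]; first by rewrite lmul0r.
  by rewrite lmulDr E1 E2.
by rewrite lmulUU mul1r add0r.
Qed.

Lemma lone_neq0 : lmon 1 0 != 0 :> laurent K.
Proof. by rewrite lmon.unlock monalgU_eq0 oner_eq0. Qed.

HB.instance Definition _ := GRing.Zmodule_isComNzRing.Build (laurent K)
  lmulA lmulC lmul1l lmulDl lone_neq0.

Lemma lscaleAl c g h : c *: lmul g h = lmul (c *: g) h.
Proof.
elim/laurent_ind: g => [|g1 g2 E1 E2|d k].
- by rewrite lmul0l !scaler0 lmul0l.
- by rewrite lmulDl !scalerDr lmulDl E1 E2.
elim/laurent_ind: h => [|h1 h2 E1 E2|e l].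
- by rewrite !lmul0r scaler0.
- by rewrite !(lmulDr _ h1) scalerDr E1 E2.
- by rewrite lmonZ !lmulUU lmonZ mulrA.
Qed.

HB.instance Definition _ := GRing.Lmodule_isLalgebra.Build K (laurent K)
  lscaleAl.
HB.instance Definition _ := GRing.Lalgebra_isComAlgebra.Build K (laurent K).

Definition laur_s : laurent K := lmon 1 (1, 0).
Definition laur_t : laurent K := lmon 1 (0, 1).

End Laurent.

Section RationalNormalCurve.
Variables (K : comNzRingType) (n : nat).

Local Notation s := (laur_s K).
Local Notation t := (laur_t K).

(* K[s, st, ..., st^n]: the smallest subalgebra containing the generators *)
Definition rnc_pred : {pred laurent K} := fun f =>
  `[< forall S : {pred laurent K}, subalg_closed S ->
      (forall i : nat, (i <= n)%N -> s * t ^+ i \in S) -> f \in S >].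

Fact rnc_subalg_closed : subalg_closed rnc_pred.
Proof.
split=> [|a u v|u v]; rewrite -!topredE /=.
- by apply/asboolP => S [].
- move=> /asboolP uS /asboolP vS; apply/asboolP => S SS Sg.
  by case: (SS) => _ SZ _; apply: SZ; [apply: uS | apply: vS].
- move=> /asboolP uS /asboolP vS; apply/asboolP => S SS Sg.
  by case: (SS) => _ _ SM; apply: SM; [apply: uS | apply: vS].
Qed.

HB.instance Definition _ :=
  GRing.isSubalgClosed.Build K (laurent K) rnc_pred rnc_subalg_closed.

Record rnc : Type := Rnc { rnc_val : laurent K; _ : rnc_val \in rnc_pred }.

HB.instance Definition _ := [isSub for rnc_val].
HB.instance Definition _ := [Choice of rnc by <:].
HB.instance Definition _ := [SubChoice_isSubComNzRing of rnc by <:].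
HB.instance Definition _ := [SubZmodule_isSubLmodule of rnc by <:].
HB.instance Definition _ := [SubNzRing_SubLmodule_isSubLalgebra of rnc by <:].
HB.instance Definition _ := [SubLalgebra_isSubAlgebra of rnc by <:].

(* the generators s t^i with a <= i <= b *)
Definition rnc_gens (a b : nat) : set rnc :=
  [set f | exists i : nat, (a <= i <= b)%N /\ \val f = s * t ^+ i].

Definition rnc_P1 : set rnc := ideal_gen (rnc_gens 1 n).
Definition rnc_P2 : set rnc := ideal_gen (rnc_gens 0 n.-1).

End RationalNormalCurve.

Arguments rnc_pred : clear implicits.
Arguments rnc_gens : clear implicits.
Arguments rnc_P1 : clear implicits.
Arguments rnc_P2 : clear implicits.

(* Main.v *)
Require Import Defs.
From HB Require Import structures.
From mathcomp Require Import all_boot all_order all_algebra.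
From mathcomp Require Import finmap.
From mathcomp Require Import boolp classical_sets reals.
From mathcomp Require Import complex.
From mathcomp Require Import monalg.
From mathcomp Require Import ring zify.

(* In terms of the exponents (a, b) of the monomials s^a t^b, the elements of R
   are supported on 0 <= b <= n a and those of J on 0 < b < n a.

   For n <= 2 there is a monomial g with b = n a - b = 1. Then J = g R, and an
   operator with values in J can be divided by g.

   For n >= 3 no monomial of J has b = n a - b = 1. The operator
   s^a t^b |-> b (n a - b) s^a t^b has values in J; suppose that it is a sum of
   products j e. Split every j into a part with b >= 2 and a part with
   n a - b >= 2, and let e1 be the operator obtained from the first parts. The
   coefficient h(a, b) of s^a t^b in e1(s^a t^b) vanishes for b = 1 and is equal
   to b for n a - b = 1. But h is polynomial in (a, b), because the commutator
   with a monomial acts on coefficients as a difference operator, and the two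
   lines cross at the point (2 / n, 1), where the two values disagree. *)

Set Implicit Arguments.
Unset Strict Implicit.
Unset Printing Implicit Defensive.

Import Order.TTheory GRing.Theory Num.Theory.

Local Open Scope classical_set_scope.
Local Open Scope ring_scope.

Section DifferentialOperators.
Variables (K : comNzRingType) (A : comAlgType K).
Implicit Types (d e : A -> A) (f g : A) (J : set A).

Lemma diffop_ordS m d : diffop_ord m d -> diffop_ord m.+1 d.
Proof.
elim: m d => [|m IHm] d [ld cd]; split=> // f; last exact: IHm (cd f).
split=> [a x y|g x]; first by rewrite !cd scaler0 addr0.
by rewrite /commutator -!/(commutator d f _) !cd mulr0 subr0.
Qed.

Lemma diffop_ordW m k d : (m <= k)%N -> diffop_ord m d -> diffop_ord k d.
Proof.
move=> /subnK <-; elim: (k - m)%N => [|i IHi] // /IHi.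
by rewrite addSn => /diffop_ordS.
Qed.

Lemma commutatorD d e f :
  commutator (fun x => d x + e x) f =
  (fun x => commutator d f x + commutator e f x).
Proof. by apply/funext => x; rewrite /commutator; ring. Qed.

Lemma commutator_mull g d f :
  commutator (fun x => g * d x) f = (fun x => g * commutator d f x).
Proof. by apply/funext => x; rewrite /commutator; ring. Qed.

Lemma diffop_ordD m d e :
  diffop_ord m d -> diffop_ord m e -> diffop_ord m (fun x => d x + e x).
Proof.
elim: m d e => [|m IHm] d e [ld cd] [le ce].
  split=> [a x y|f x]; first by rewrite ld le scalerDr addrACA.
  by rewrite commutatorD cd ce addr0.
split=> [a x y|f]; first by rewrite ld le scalerDr addrACA.
by rewrite commutatorD; exact: IHm (cd f) (ce f).
Qed.

Lemma diffop_ord_mull m g d : diffop_ord m d -> diffop_ord m (fun x => g * d x).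
Proof.
have lin e : linear e -> linear (fun x => g * e x).
  by move=> le a x y; rewrite le mulrDr scalerAr.
elim: m d => [|m IHm] d [ld cd]; (split=> [|f]; first exact: lin).
  by move=> x; rewrite commutator_mull cd mulr0.
by rewrite commutator_mull; exact: IHm (cd f).
Qed.

Lemma diffop_ord_div m g d : injective ( *%R g) ->
  diffop_ord m (fun x => g * d x) -> diffop_ord m d.
Proof.
move=> gI.
have lin e : linear (fun x => g * e x) -> linear e.
  by move=> le a x y; apply: gI; rewrite le mulrDr scalerAr.
elim: m d => [|m IHm] d [ld cd]; (split=> [|f]; first exact: lin).
  by move=> x; apply: gI; rewrite mulr0 -(cd f x) commutator_mull.
by apply: IHm; rewrite -commutator_mull; exact: cd f.
Qed.

Lemma diffop0 : diffop (fun _ : A => 0 : A).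
Proof.
exists 0; split=> [a x y|f x]; first by rewrite scaler0 addr0.
by rewrite /commutator mulr0 subr0.
Qed.

Lemma diffopD d e : diffop d -> diffop e -> diffop (fun x => d x + e x).
Proof.
move=> [m dm] [k ek]; exists (maxn m k).
by apply: diffop_ordD; [apply: diffop_ordW dm | apply: diffop_ordW ek];
  rewrite ?leq_maxl ?leq_maxr.
Qed.

Lemma diffop_mull g d : diffop d -> diffop (fun x => g * d x).
Proof. by move=> [m dm]; exists m; apply: diffop_ord_mull. Qed.

Lemma diffop_sum m (j : 'I_m -> A) (e : 'I_m -> A -> A) :
  (forall i, diffop (e i)) -> diffop (fun x => \sum_i j i * e i x).
Proof.
elim: m j e => [|m IHm] j e De.
  rewrite (_ : (fun _ => _) = fun=> 0); first exact: diffop0.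
  by apply/funext => x; rewrite big_ord0.
rewrite (_ : (fun _ => _) = fun x => j ord0 * e ord0 x +
    \sum_i j (lift ord0 i) * e (lift ord0 i) x); last first.
  by apply/funext => x; rewrite big_ord_recl.
by apply: diffopD; [apply: diffop_mull | apply: IHm].
Qed.

Lemma ideal_diffop_sub J : J 0 -> (forall f g, J f -> J g -> J (f + g)) ->
  (forall f g, J f -> J (f * g)) -> ideal_diffop J `<=` diffop_into J.
Proof.
move=> J0 JD JM _ [m [j [e [Jj De ->]]]]; split; first exact: diffop_sum.
by move=> f; apply: big_ind => // i _; apply: JM.
Qed.

Lemma principal_ideal_diffop J g : injective ( *%R g) ->
  (forall f, J f <-> exists r, f = g * r) -> ideal_diffop J = diffop_into J.
Proof.
move=> gI JE; apply/seteqP; split.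
  apply: ideal_diffop_sub => [|f h|f h].
  - by apply/JE; exists 0; rewrite mulr0.
  - by move=> /JE[r ->] /JE[r' ->]; apply/JE; exists (r + r'); rewrite mulrDr.
  - by move=> /JE[r ->]; apply/JE; exists (r * h); rewrite mulrA.
move=> d [[m dm] dJ].
have /choice[e eE] : forall f, exists r, d f = g * r by move=> f; apply/JE.
have dE : d = fun x => g * e x by apply/funext.
exists 1, (fun=> g), (fun=> e); split=> [_|_|].
- by apply/JE; exists 1; rewrite mulr1.
- by exists m; apply: (diffop_ord_div gI); rewrite -dE.
- by rewrite dE; apply/funext => x; rewrite big_ord1.
Qed.

Definition derivation d :=
  linear d /\ forall f g, d (f * g) = d f * g + f * d g.

Lemma diffop_ord_derivation2 d e :
  derivation d -> derivation e -> diffop_ord 2 (d \o e).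
Proof.
move=> [ld Md] [le Me].
have dD x y : d (x + y) = d x + d y by have:= ld 1 x y; rewrite !scale1r.
have cE f : commutator (d \o e) f =
    fun x => d (e f) * x + e f * d x + d f * e x.
  by apply/funext => x; rewrite /commutator /= Me dD !Md; ring.
have ccE f g : commutator (commutator (d \o e) f) g =
    fun x => (e f * d g + d f * e g) * x.
  by apply/funext => x; rewrite cE /commutator Md Me; ring.
split=> [a x y|f]; first by rewrite /= le ld.
split=> [a x y|g].
  rewrite cE ld le !mulrDr -!scalerAr !scalerDr [RHS]addrACA.
  by congr (_ + _); apply: addrACA.
rewrite ccE; split=> [a x y|h x]; first by rewrite mulrDr scalerAr.
by rewrite /commutator; ring.
Qed.

End DifferentialOperators.

Section Support.
Variable K : comNzRingType.
Implicit Types (f g : laurent K) (T : pred (int * int)).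

Definition supp_in T g := forall k, g@_k != 0 -> T k.

Lemma lcoef_lmonM c k g l : (lmon c k * g)@_l = c * g@_(l - k).
Proof.
elim/laurent_ind: g => [|g h Eg Eh|d m].
- by rewrite mulr0 !mcoeff0 mulr0.
- by rewrite mulrDr !mcoeffD Eg Eh mulrDr.
rewrite [lmon c k * _]lmulUU !lcoefU mulrnAr; congr (_ *+ _).
by rewrite [in RHS]eq_sym subr_eq addrC eq_sym.
Qed.

Lemma supp_in_sum T (I : Type) (r : seq I) (F : I -> laurent K) :
  (forall i, supp_in T (F i)) -> supp_in T (\sum_(i <- r) F i).
Proof.
move=> TF; apply: (big_ind (supp_in T)) => // [k|f g Tf Tg k].
  by rewrite mcoeff0 eqxx.
rewrite mcoeffD; have [->|/Tf //] := eqVneq f@_k 0.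
by rewrite add0r => /Tg.
Qed.

Lemma supp_in_linear T a f g : supp_in T f -> supp_in T g ->
  supp_in T (a *: f + g).
Proof.
move=> Tf Tg k; rewrite mcoeffD mcoeffZ.
have [->|/Tf //] := eqVneq f@_k 0.
by rewrite mulr0 add0r => /Tg.
Qed.

Lemma supp_in_lmon T c k : T k -> supp_in T (lmon c k).
Proof.
by move=> Tk l; rewrite lcoefU; case: (k =P l) => [<-//|]; rewrite eqxx.
Qed.

Lemma supp_inM T1 T2 T f g : (forall k l, T1 k -> T2 l -> T (k + l)) ->
  supp_in T1 f -> supp_in T2 g -> supp_in T (f * g).
Proof.
move=> TD fT gT k; have -> : f * g = lmul f g by [].
rewrite lmul.unlock; apply: contraNT => nTk.
rewrite raddf_sum big1_seq // => i /=; rewrite -mcoeff_neq0 => fi.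
rewrite raddf_sum big1_seq // => j /=; rewrite -mcoeff_neq0 => gj.
rewrite lcoefU; case: eqP => // ij; case/negP: nTk.
by rewrite -ij; apply: TD; [apply: fT | apply: gT].
Qed.

Lemma laur_gen i : laur_s K * laur_t K ^+ i = lmon 1 (1, i%:Z).
Proof.
suff -> : laur_t K ^+ i = lmon 1 (0, i%:Z).
  by rewrite [LHS]lmulUU mulr1; congr lmon.
by elim: i => [|i IHi] //; rewrite exprS IHi [LHS]lmulUU mulr1; congr lmon.
Qed.

Lemma laur_sst : laur_s K ^+ 2 * laur_t K = lmon 1 (2, 1).
Proof. by rewrite expr2 -mulrA -[laur_t K]expr1 laur_gen [LHS]lmulUU mulr1. Qed.

Definition lscale (w : int * int -> K) g : laurent K :=
  \sum_(k <- msupp g) lmon (w k * g@_k) k.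

Lemma lcoef_lscale w g k : (lscale w g)@_k = w k * g@_k.
Proof.
rewrite raddf_sum /=; have [gk|gk] := boolP (k \in msupp g).
  rewrite (big_fsetD1 k) //= lcoefUU big1_seq ?addr0 // => l /=.
  by rewrite !inE => /andP[/negPf lk _]; rewrite lcoefU lk.
rewrite (mcoeff_outdom gk) mulr0 big1_seq // => l /= lg.
by rewrite lcoefU; have [lk|_ //] := eqVneq l k; rewrite -lk lg in gk.
Qed.

Lemma supp_in_lscale T w g : supp_in T g -> supp_in T (lscale w g).
Proof.
move=> Tg k; rewrite lcoef_lscale => wk; apply: Tg.
by apply: contraNneq wk => ->; rewrite mulr0.
Qed.

Lemma lscale_linear w : linear (lscale w).
Proof.
move=> a f g; apply/malgP => k.
by rewrite lcoef_lscale 2!mcoeffD 2!mcoeffZ 2!lcoef_lscale mulrDr mulrCA.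
Qed.

Lemma lscale_lmon w c k : lscale w (lmon c k) = lmon (w k * c) k.
Proof.
apply/malgP => l; rewrite lcoef_lscale !lcoefU.
by case: eqP => [->|] //; rewrite mulr0.
Qed.

Lemma lscaleM w f g : (forall k l, w (k + l) = w k + w l) ->
  lscale w (f * g) = lscale w f * g + f * lscale w g.
Proof.
move=> wD; have lscaleD h1 h2 : lscale w (h1 + h2) = lscale w h1 + lscale w h2.
  by have := lscale_linear w 1 h1 h2; rewrite !scale1r.
have lscale0 : lscale w 0 = 0.
  by apply/malgP => k; rewrite lcoef_lscale mcoeff0 mulr0.
elim/laurent_ind: f => [|f1 f2 E1 E2|c k].
- by rewrite lscale0 !mul0r lscale0 addr0.
- by rewrite mulrDl !lscaleD !mulrDl E1 E2 addrACA.
elim/laurent_ind: g => [|g1 g2 E1 E2|d l].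
- by rewrite lscale0 !mulr0 lscale0 addr0.
- by rewrite mulrDr !lscaleD !mulrDr E1 E2 addrACA.
rewrite [lmon c k * _]lmulUU !lscale_lmon ![_ * lmon _ _]lmulUU -lmonD wD.
by congr lmon; ring.
Qed.

End Support.

Section Cone.
Variables (K : comNzRingType) (n : nat).
Hypothesis n_gt0 : (0 < n)%N.
Implicit Types (f g : rnc K n) (k l m : int * int) (T : pred (int * int)).

Definition facet2 k : int := n%:Z * k.1 - k.2.
Definition cone : pred (int * int) := fun k => (0 <= k.2) && (0 <= facet2 k).

Lemma facet2D k l : facet2 (k + l) = facet2 k + facet2 l.
Proof. by rewrite /facet2 /=; ring. Qed.

Lemma coneD k l : cone k -> cone l -> cone (k + l).
Proof.
rewrite /cone facet2D => /andP[k1 k2] /andP[l1 l2].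
by rewrite (addr_ge0 k2 l2) andbT; apply: addr_ge0.
Qed.

Lemma cone_nat (a b : nat) : cone (a%:Z, b%:Z) = (b <= n * a)%N.
Proof. by rewrite /cone /facet2 /= subr_ge0 -PoszM lez_nat. Qed.

Lemma coneP k : reflect (exists a b : nat, k = (a%:Z, b%:Z) /\ (b <= n * a)%N)
                        (cone k).
Proof.
apply: (iffP idP) => [|[a [b [-> ab]]]]; last by rewrite cone_nat.
case: k => [a b] /[dup] ck; rewrite /cone /facet2 /= => /andP[b0 nab].
have a0 : 0 <= a.
  by rewrite -(@pmulr_rge0 _ n%:Z) ?ltz_nat // (le_trans b0) // -subr_ge0.
exists `|a|%N, `|b|%N; rewrite !gez0_abs //; split=> //.
by rewrite -cone_nat !gez0_abs.
Qed.

Lemma rnc_val_inj : injective (@rnc_val K n).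
Proof. exact: val_inj. Qed.

Lemma rnc_val_sum (I : Type) (r : seq I) (F : I -> rnc K n) :
  rnc_val (\sum_(i <- r) F i) = \sum_(i <- r) rnc_val (F i).
Proof. exact: (raddf_sum (val : rnc K n -> laurent K)). Qed.

Lemma supp_in_rnc (h : laurent K) : h \in rnc_pred K n <-> supp_in cone h.
Proof.
split=> [|hT].
  pose S : {pred laurent K} := fun h => `[< supp_in cone h >].
  have SE h' : (h' \in S) = `[< supp_in cone h' >] by [].
  move=> /asboolP/(_ S); rewrite SE => hS; apply/asboolP/hS => [|i ni].
    split=> [|a u v|u v]; rewrite !SE.
    - by apply/asboolP/supp_in_lmon.
    - by move=> /asboolP cu /asboolP cv; apply/asboolP/supp_in_linear.
    - move=> /asboolP cu /asboolP cv; apply/asboolP.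
      exact: supp_inM coneD cu cv.
  by rewrite laur_gen SE; apply/asboolP/supp_in_lmon; rewrite cone_nat muln1.
have gen i : (i <= n)%N -> (lmon 1 (1, i%:Z) : laurent K) \in rnc_pred K n.
  by move=> ni; rewrite -laur_gen; apply/asboolP => S _; apply.
rewrite (laurentE h) big_seq; apply: rpred_sum => k.
rewrite -mcoeff_neq0 => /hT/coneP[a [b [-> ab]]].
rewrite -[h@_ _]mulr1 -lmonZ; apply: rpredZ.
elim: a b ab => [|a IHa] b ab.
  by rewrite muln0 leqn0 in ab; rewrite (eqP ab); apply: rpred1.
have -> : lmon 1 (a.+1%:Z, b%:Z) =
    lmon 1 (1, (minn b n)%:Z) * lmon 1 (a%:Z, (b - minn b n)%N%:Z) :> laurent K.
  rewrite [RHS]lmulUU mulr1; congr lmon; congr pair => /=.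
  by rewrite -PoszD subnKC // geq_minl.
by apply: rpredM; [apply/gen/geq_minr | apply: IHa; lia].
Qed.

Definition rmon k : rnc K n := insubd 0 (lmon 1 k).

Lemma val_rmon k : cone k -> rnc_val (rmon k) = lmon 1 k.
Proof.
move=> ck; rewrite [LHS]val_insubd ifT //; apply/supp_in_rnc/supp_in_lmon.
exact: ck.
Qed.

Lemma supp_in_val f : supp_in cone (rnc_val f).
Proof. exact/supp_in_rnc/valP. Qed.

Lemma rmonM k l : cone k -> cone l -> rmon k * rmon l = rmon (k + l).
Proof.
move=> ck cl; apply: rnc_val_inj; rewrite /= !val_rmon ?coneD //.
by rewrite [LHS]lmulUU mulr1.
Qed.

Lemma rnc_valZ_rmonM c k l : cone k -> cone l ->
  rnc_val ((c *: rmon k) * rmon l) = lmon c (k + l).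
Proof.
move=> ck cl; transitivity ((c *: lmon 1 k) * lmon 1 l : laurent K).
  by rewrite -!val_rmon.
by rewrite lmonZ mulr1 [LHS]lmulUU mulr1.
Qed.

Lemma ideal_gen_monomials (G : set (rnc K n)) (M : set (int * int)) T :
  (forall g, G g <-> exists2 m, M m & rnc_val g = lmon 1 m) ->
  (forall m k, M m -> cone k -> T (m + k)) ->
  (forall k, cone k -> T k -> exists m, [/\ M m, cone m & cone (k - m)]) ->
  forall f, ideal_gen G f <-> supp_in T (rnc_val f).
Proof.
move=> GE MT TM f; split=> [[p [r [g [Gg ->]]]]|fT].
  rewrite rnc_val_sum; apply: supp_in_sum => i.
  have /GE[m Mm gE] := Gg i; rewrite /= gE mulrC.
  move=> k; rewrite lcoef_lmonM mul1r => /supp_in_val/(MT _ _ Mm).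
  by rewrite addrC subrK.
have /choice[m mE] : forall k, exists m,
    k \in msupp (rnc_val f) -> [/\ M m, cone m & cone (k - m)].
  move=> k; have [kf|_] := boolP (k \in msupp (rnc_val f)); last by exists 0.
  rewrite -mcoeff_neq0 in kf.
  by have [m mP] := TM k (supp_in_val kf) (fT k kf); exists m.
pose s : seq (int * int) := msupp (rnc_val f); pose z i := nth 0 s i.
have zs i : (i < size s)%N -> z i \in msupp (rnc_val f) by apply: mem_nth.
exists (size s), (fun i => (rnc_val f)@_(z i) *: rmon (z i - m (z i))),
  (fun i => rmon (m (z i))).
split=> [i|].
  have [Mm cm _] := mE _ (zs i (ltn_ord i)).
  by apply/GE; exists (m (z i)); rewrite ?val_rmon.
apply: rnc_val_inj; rewrite rnc_val_sum [LHS]laurentE (big_nth 0) big_mkord.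
apply: eq_bigr => i _; have [_ cm ck] := mE _ (zs i (ltn_ord i)).
by rewrite rnc_valZ_rmonM // subrK.
Qed.

End Cone.

Section Interpolation.
Variable K : numFieldType.
Implicit Types (p q : {poly K}) (f : nat -> K).

Lemma poly_eq_nat p q (m : nat) :
  (forall k : nat, (m <= k)%N -> p.[k%:R] = q.[k%:R]) -> p = q.
Proof.
move=> pq; apply/eqP; rewrite -subr_eq0; apply/eqP.
pose rs : seq K := [seq k%:R | k <- iota m (size (p - q))].
apply: (@roots_geq_poly_eq0 _ _ rs); last by rewrite size_map size_iota.
  apply/allP => _ /mapP[k + ->]; rewrite mem_iota => /andP[mk _].
  by rewrite /root !hornerE pq // subrr.
by rewrite map_inj_uniq ?iota_uniq // => k l /eqP; rewrite eqr_nat => /eqP.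
Qed.

Definition bin_poly i : {poly K} :=
  i`!%:R^-1 *: \prod_(j < i) ('X - (j%:R)%:P).

Lemma bin_polyE i (u : nat) : (bin_poly i).[u%:R] = 'C(u, i)%:R.
Proof.
have i0 : i`!%:R != 0 :> K by rewrite pnatr_eq0 -lt0n fact_gt0.
apply: (mulfI i0); rewrite hornerZ mulrA divff // mul1r -natrM mulnC bin_ffact.
elim: i {i0} => [|i IHi]; first by rewrite big_ord0 hornerE.
rewrite big_ord_recr hornerM IHi !hornerE ffactnSr natrM.
have [iu|ui] := leqP i u; first by rewrite natrB.
by rewrite ffact_small // !mul0r.
Qed.

(* [X^k] is read as evaluation at [k], so ['X - 1] is the difference operator. *)
Definition umbral f p : K := \sum_(k < size p) p`_k * f k.

Lemma umbralE f p m : (size p <= m)%N -> umbral f p = \sum_(k < m) p`_k * f k.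
Proof.
move=> pm.
rewrite /umbral (big_ord_widen m (fun k => p`_k * f k)) // big_mkcond.
by apply: eq_bigr => k _; case: ltnP => // pk; rewrite nth_default ?mul0r.
Qed.

Lemma umbralD f p q : umbral f (p + q) = umbral f p + umbral f q.
Proof.
pose m := maxn (size p) (size q).
rewrite (@umbralE _ (p + q) m) ?size_polyD // (@umbralE _ p m) ?leq_maxl //.
rewrite (@umbralE _ q m) ?leq_maxr // -big_split; apply: eq_bigr => k _.
by rewrite coefD mulrDl.
Qed.

Lemma umbral0 f : umbral f 0 = 0.
Proof. by rewrite /umbral size_poly0 big_ord0. Qed.

Lemma umbral_sum f (m : nat) (F : nat -> {poly K}) :
  umbral f (\sum_(i < m) F i) = \sum_(i < m) umbral f (F i).
Proof.
elim: m => [|m IHm]; first by rewrite !big_ord0 umbral0.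
by rewrite !big_ord_recr umbralD IHm.
Qed.

Lemma umbralMn f p m : umbral f (p *+ m) = umbral f p *+ m.
Proof.
by elim: m => [|m IHm]; rewrite ?umbral0 // !mulrS umbralD IHm.
Qed.

Lemma umbralXn f u : umbral f 'X^u = f u.
Proof.
rewrite /umbral size_polyXn big_ord_recr /= coefXn eqxx mul1r big1 ?add0r //.
by move=> i _; rewrite coefXn ltn_eqF ?mul0r //=.
Qed.

Lemma umbral_diff f p :
  umbral f (('X - 1) * p) = umbral (fun k => f k.+1 - f k) p.
Proof.
pose m := (size p).+1.
rewrite (@umbralE _ _ m.+1); last first.
  by rewrite (leq_trans (size_polyMleq _ _)) // size_XsubC.
rewrite (@umbralE _ p m) ?leqnSn //.
under eq_bigr do rewrite mulrBl mul1r coefB coefXM mulrBl.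
rewrite sumrB big_ord_recl /= mul0r add0r [X in _ - X]big_ord_recr /=.
rewrite [p`_m]nth_default ?leqnSn // mul0r addr0 -sumrB.
by apply: eq_bigr => i _; rewrite mulrBr.
Qed.

Definition diff_nilpotent m f := forall p, umbral f (('X - 1) ^+ m * p) = 0.

Lemma umbral_interpolation m : exists L : nat -> {poly K}, forall f,
  diff_nilpotent m f -> forall u : nat, f u = \sum_(k < m) f k * (L k).[u%:R].
Proof.
pose c i k : K := (('X - 1) ^+ i)`_k.
exists (fun k => \sum_(i < m) c i k *: bin_poly i) => f fm u.
have fi i : (m <= i)%N -> umbral f (('X - 1) ^+ i) = 0.
  by move=> /subnK <-; rewrite addnC exprD fm.
have cE i : (i < m)%N -> umbral f (('X - 1) ^+ i) = \sum_(k < m) c i k * f k.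
  by move=> im; apply: umbralE; rewrite size_exp_XsubC.
rewrite -[LHS]umbralXn -[X in umbral f (X ^+ u)](subrK 1) addrC exprDn.
under eq_bigr do rewrite expr1n mul1r.
rewrite (umbral_sum f u.+1 (fun i => ('X - 1) ^+ i *+ 'C(u, i))).
under eq_bigr do rewrite umbralMn.
pose F i := umbral f (('X - 1) ^+ i) *+ 'C(u, i).
transitivity (\sum_(i < m) F i).
  have [mu|um] := leqP m u.+1.
    rewrite [RHS](big_ord_widen u.+1 F) // [RHS]big_mkcond.
    by apply: eq_bigr => i _; case: ltnP => // /fi ->; rewrite mul0rn.
  rewrite (big_ord_widen m F) 1?ltnW // big_mkcond.
  by apply: eq_bigr => i _; case: ltnP => // ui; rewrite /F bin_small.
rewrite /F; under eq_bigr => i _ do rewrite cE // -mulr_natr mulr_suml.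
rewrite exchange_big; apply: eq_bigr => k _ /=.
rewrite horner_sum mulr_sumr; apply: eq_bigr => i _.
by rewrite hornerZ bin_polyE mulrCA mulrA.
Qed.

End Interpolation.

Section BivariateInterpolation.
Variables (K : numFieldType) (n m : nat) (h : nat -> nat -> K).
Hypothesis n_gt0 : (0 < n)%N.
Hypothesis h_horizontal : forall a b, (b <= n * a)%N ->
  diff_nilpotent m (fun u => h (a + u) b).
Hypothesis h_diagonal : forall a b, (b <= n * a)%N ->
  diff_nilpotent m (fun u => h (a + u) (b + u)).

Definition bivariate (L : nat -> {poly K}) (x y : K) : K :=
  \sum_(i < m) \sum_(j < m) h (i + j) j * ((L i).[x - y] * (L j).[y]).

Definition bivariate_poly (L : nat -> {poly K}) (p q : {poly K}) : {poly K} :=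
  \sum_(i < m) \sum_(j < m) h (i + j) j *: ((L i \Po (p - q)) * (L j \Po q)).

Lemma horner_bivariate L p q x :
  (bivariate_poly L p q).[x] = bivariate L p.[x] q.[x].
Proof.
rewrite horner_sum; apply: eq_bigr => i _.
rewrite horner_sum; apply: eq_bigr => j _.
by rewrite hornerZ hornerM !horner_comp hornerD hornerN.
Qed.

(* On [b <= a] this is interpolation along [(1, 0)] and [(1, 1)]; a point with
   [b > a] is moved there along [(1, 0)]. *)
Lemma bivariate_interpolation : exists L, forall a b, (b <= n * a)%N ->
  h a b = bivariate L a%:R b%:R.
Proof.
have [L LE] := umbral_interpolation K m; exists L.
have sub a b : (b <= a)%N -> h a b = bivariate L a%:R b%:R.
  move=> ba; have /= := LE _ (h_horizontal (leq_pmull b n_gt0)) (a - b)%N.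
  rewrite subnKC // => ->; apply: eq_bigr => i _.
  have /= := LE _ (h_diagonal (leq0n (n * i))) b.
  rewrite add0n [(b + i)%N]addnC => ->.
  rewrite mulr_suml; apply: eq_bigr => j _.
  by rewrite add0n natrB // mulrAC mulrA.
move=> a b ab.
pose p := \sum_(j < m) h (a + j) b *: L j.
have pE (u : nat) : h (a + u) b = p.[u%:R].
  rewrite (LE _ (h_horizontal ab) u) horner_sum.
  by apply: eq_bigr => j _; rewrite hornerZ.
have pq : p = bivariate_poly L ('X + (a%:R)%:P) (b%:R)%:P.
  apply: (@poly_eq_nat _ _ _ b) => u bu.
  rewrite -pE horner_bivariate !hornerE -natrD [(u + a)%N]addnC.
  by apply/sub/(leq_trans bu)/leq_addl.
have := pE 0; rewrite addn0 pq horner_bivariate.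
by rewrite !hornerE.
Qed.

Lemma crossing_facet_lines :
  (forall a, (0 < a)%N -> h a 1 = 0) ->
  ~ (forall a, (0 < a)%N -> h a (n * a).-1 = (n * a).-1%:R).
Proof.
move=> h1 h2; have [L LE] := bivariate_interpolation.
have n0 : n%:R != 0 :> K by rewrite pnatr_eq0 -lt0n.
have na1 a : (0 < a)%N -> (n * a).-1%:R = n%:R * a%:R - 1 :> K.
  by move=> a0; rewrite -subn1 natrB ?muln_gt0 ?n_gt0 // natrM.
have E1 : bivariate_poly L 'X 1 = 0.
  apply: (@poly_eq_nat _ _ _ 1) => a a0.
  rewrite horner_bivariate !hornerE -(LE _ 1) ?h1 //.
  by rewrite muln_gt0 n_gt0.
have E2 : bivariate_poly L 'X (n%:R *: 'X - 1) = n%:R *: 'X - 1.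
  apply: (@poly_eq_nat _ _ _ 1) => a a0.
  rewrite horner_bivariate !hornerE -na1 // -LE ?h2 //.
  exact: leq_pred.
have [x nx] : exists x : K, n%:R * x = 2.
  by exists (2 / n%:R); rewrite mulrC divfK.
have := congr1 (horner^~ x) E2; have := congr1 (horner^~ x) E1.
rewrite /= !horner_bivariate !hornerE nx.
have -> : 2 - 1 = 1 :> K by ring.
by move=> -> /eqP; rewrite eq_sym oner_eq0.
Qed.

End BivariateInterpolation.

Section Ideals.
Variables (K : comNzRingType) (n : nat).
Hypothesis n_gt0 : (0 < n)%N.
Implicit Types (f g : rnc K n) (k m : int * int) (J : set (rnc K n)).

Lemma ideal_rnc_gens lo hi : (lo <= hi <= n)%N -> (0 < lo)%N || (hi < n)%N ->
  forall f, ideal_gen (rnc_gens K n lo hi) f <->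
    supp_in (fun k => (lo%:Z <= k.2) && (n%:Z - hi%:Z <= facet2 n k))
      (rnc_val f).
Proof.
move=> /andP[lohi hin] lohin.
apply: (ideal_gen_monomials n_gt0
    (M := [set m | exists2 i, (lo <= i <= hi)%N & m = (1, i%:Z)])).
- move=> g; split=> [[i [lihi gE]]|[_ [i lihi ->] gE]].
    by exists (1, i%:Z); [exists i | rewrite -laur_gen].
  by exists i; split; rewrite ?laur_gen.
- move=> _ k [i /andP[loi ihi] ->] /andP[k1 k2].
  by rewrite facet2D {1}/facet2 /=; lia.
- move=> _ /(coneP n_gt0)[a [b [-> ab]]]; rewrite /facet2 /= => /andP[lob hib].
  have a0 : (0 < a)%N by case: a ab hib => // ab hib; lia.
  exists (1, (maxn lo (b - n * a.-1))%:Z); split.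
  + exists (maxn lo (b - n * a.-1)) => //.
    case: a a0 ab hib => // a _ ab hib; rewrite mulnS in ab; lia.
  + rewrite cone_nat muln1.
    by case: a a0 ab hib => // a _ ab hib; rewrite mulnS in ab; lia.
  + rewrite /cone /facet2 /=.
    case: a a0 ab hib => // a _ ab hib; rewrite mulnS in ab; lia.
Qed.

Definition interior : pred (int * int) :=
  fun k => (0 < k.2) && (0 < facet2 n k).

Lemma facet_idealsI f :
  (rnc_P1 K n `&` rnc_P2 K n) f <-> supp_in interior (rnc_val f).
Proof.
split=> [[]|fT].
  move=> /ideal_rnc_gens f1 /ideal_rnc_gens f2 k fk; rewrite /interior.
  have := f1 _ _ k fk; have := f2 _ _ k fk; rewrite /=; lia.
split; apply/ideal_rnc_gens => //; rewrite ?leqnn ?leq_pred //; try lia;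
  move=> k /fT; rewrite /interior; lia.
Qed.

Lemma facet_idealsI_gens : (1 < n)%N ->
  rnc_P1 K n `&` rnc_P2 K n = ideal_gen (rnc_gens K n 1 n.-1).
Proof.
move=> n1; apply/seteqP; split=> f.
  move=> /facet_idealsI fT; apply/ideal_rnc_gens; try lia.
  by move=> k /fT; rewrite /interior; lia.
move=> /ideal_rnc_gens fT; apply/facet_idealsI => k /fT; rewrite /interior.
by move=> /(_ _ _); lia.
Qed.

Lemma facet_idealsI_n1 : n = 1%N ->
  rnc_P1 K n `&` rnc_P2 K n =
  ideal_gen [set f : rnc K n | \val f = laur_s K ^+ 2 * laur_t K].
Proof.
move=> n1; have gen f :
    ideal_gen [set f : rnc K n | \val f = laur_s K ^+ 2 * laur_t K] f <->
    supp_in interior (rnc_val f).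
  apply: (ideal_gen_monomials n_gt0 (M := [set (2, 1)])).
  - by move=> g; rewrite /= laur_sst; split=> [|[_ ->]] //; exists (2, 1).
  - by move=> _ k ->; rewrite /cone /interior /facet2 n1 /=; lia.
  - move=> [a b] _; rewrite /interior /facet2 n1 /= => /andP[b0 ab].
    by exists (2, 1); split; rewrite // /cone /facet2 /=; lia.
by apply/seteqP; split=> f => [/facet_idealsI/gen | /gen/facet_idealsI].
Qed.

Lemma rmon_mul_inj k : cone n k -> injective ( *%R (rmon K n k)).
Proof.
move=> ck f g /(congr1 (@rnc_val K n)) /= fg.
apply: rnc_val_inj; apply/malgP => l.
have := congr1 (fun h : laurent K => h@_(l + k)) fg.
by rewrite (val_rmon _ n_gt0 ck) !lcoef_lmonM !mul1r addrK.
Qed.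

Lemma ideal_gen_rmon (G : set (rnc K n)) k : cone n k ->
  (forall g, G g <-> rnc_val g = lmon 1 k) ->
  forall f, ideal_gen G f <-> exists r, f = rmon K n k * r.
Proof.
move=> ck GE f; split=> [[p [r [g [Gg ->]]]]|[r ->]].
  exists (\sum_i r i); rewrite mulr_sumr; apply: eq_bigr => i _.
  rewrite mulrC; congr (_ * _); apply: rnc_val_inj.
  by rewrite (val_rmon _ n_gt0 ck); apply/GE.
exists 1, (fun=> r), (fun=> rmon K n k); split=> [_|].
  by apply/GE; rewrite val_rmon.
by rewrite big_ord1 mulrC.
Qed.

Lemma ideal_diffop_rnc_le2 : (n <= 2)%N ->
  ideal_diffop (rnc_P1 K n `&` rnc_P2 K n) =
  diffop_into (rnc_P1 K n `&` rnc_P2 K n).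
Proof.
move=> n2; have [n1|nn1] := eqVneq n 1%N.
  have c21 : cone n (2, 1) by rewrite n1.
  apply: (principal_ideal_diffop (rmon_mul_inj c21)) => f.
  rewrite facet_idealsI_n1 //; apply: ideal_gen_rmon => // g.
  by rewrite /= laur_sst.
have {nn1}n2E : n = 2 by lia.
have c11 : cone n (1, 1) by rewrite n2E.
apply: (principal_ideal_diffop (rmon_mul_inj c11)) => f.
rewrite facet_idealsI_gens; last by rewrite n2E.
apply: ideal_gen_rmon => // g /=; split=> [[i [i1 gE]]|gE].
  by rewrite [LHS]gE laur_gen (_ : i = 1%N) //; lia.
by exists 1%N; rewrite laur_gen; split=> //; lia.
Qed.

End Ideals.

Section FacetOperator.
Variables (K : numFieldType) (n : nat).
Hypothesis n_gt0 : (0 < n)%N.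
Implicit Types (f g : rnc K n) (k v : int * int) (w : int * int -> K).
Implicit Types e : rnc K n -> rnc K n.

Fact rnc_lscale w f : lscale w (rnc_val f) \in rnc_pred K n.
Proof. exact/(supp_in_rnc n_gt0 _)/supp_in_lscale/supp_in_val. Qed.

Definition rscale w f : rnc K n := Rnc (rnc_lscale w f).

Lemma rscale_derivation w : (forall k l, w (k + l) = w k + w l) ->
  derivation (rscale w).
Proof.
move=> wD; split=> [a f g|f g]; apply: rnc_val_inj; first exact: lscale_linear.
exact: lscaleM.
Qed.

Definition facet_operator : rnc K n -> rnc K n :=
  rscale (fun k => k.2%:~R) \o rscale (fun k => (facet2 n k)%:~R).

Lemma lcoef_facet_operator f k :
  (rnc_val (facet_operator f))@_k =
  k.2%:~R * ((facet2 n k)%:~R * (rnc_val f)@_k).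
Proof. by rewrite /= !lcoef_lscale. Qed.

Lemma facet_operator_into :
  diffop_into (rnc_P1 K n `&` rnc_P2 K n) facet_operator.
Proof.
split=> [|f].
  exists 2; apply: diffop_ord_derivation2; apply: rscale_derivation => k l.
    by rewrite -intrD.
  by rewrite facet2D intrD.
apply/(facet_idealsI n_gt0) => k; rewrite lcoef_facet_operator.
rewrite !mulf_eq0 !negb_or !intr_eq0 => /and3P[k1 k2].
move=> /(supp_in_val n_gt0)/andP[k1' k2'].
by rewrite /interior; lia.
Qed.

Lemma diffop_line m e (k l v : int * int) :
  diffop_ord m e -> cone n k -> cone n v ->
  diff_nilpotent m.+1
    (fun u => (rnc_val (e (rmon K n (k + v *+ u))))@_(k + v *+ u + l)).
Proof.
move=> em ck cv; have cu u : cone n (k + v *+ u).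
  by elim: u => [|u IHu]; rewrite ?addr0 // mulrSr addrA coneD.
have diffE d l' u :
    (rnc_val (d (rmon K n (k + v *+ u.+1))))@_(k + v *+ u.+1 + l') -
    (rnc_val (d (rmon K n (k + v *+ u))))@_(k + v *+ u + l') =
    (rnc_val (commutator d (rmon K n v) (rmon K n (k + v *+ u))))@_
      (k + v *+ u + (l' + v)).
  rewrite mulrS addrCA [l' + v]addrC [in RHS]addrA [_ + v]addrC.
  rewrite mcoeffB (rmonM _ n_gt0) //; congr (_ - _).
  rewrite /= (val_rmon _ n_gt0 cv) lcoef_lmonM mul1r.
  by rewrite -addrA [v + _]addrC addrK.
elim: m e l em => [|m IHm] e l [_ ec] p;
  rewrite exprS -mulrA umbral_diff (funext (diffE e l)).
- by rewrite expr0 mul1r /umbral big1 // => u _; rewrite ec mcoeff0 mulr0.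
- exact: IHm (ec _) _.
Qed.

Definition diagonal_coef e (a b : nat) : K :=
  (rnc_val (e (rmon K n (a%:Z, b%:Z))))@_(a%:Z, b%:Z).

Lemma natpairE (a b c d u : nat) : (a%:Z, b%:Z) + (c%:Z, d%:Z) *+ u =
  ((a + c * u)%N%:Z, (b + d * u)%N%:Z) :> (int * int)%type.
Proof.
elim: u => [|u IHu]; first by rewrite addr0 !muln0 !addn0.
by rewrite mulrSr addrA IHu [LHS]surjective_pairing /=; congr pair; lia.
Qed.

Lemma diagonal_coef_line m e (a b d : nat) :
  diffop_ord m e -> (b <= n * a)%N -> (d <= n)%N ->
  diff_nilpotent m.+1 (fun u => diagonal_coef e (a + u) (b + d * u)).
Proof.
move=> em ab dn.
have ck : cone n (a%:Z, b%:Z) by rewrite cone_nat.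
have cv : cone n (1%N%:Z, d%:Z) by rewrite cone_nat muln1.
have := diffop_line 0 em ck cv; congr diff_nilpotent; apply/funext => u.
by rewrite addr0 natpairE mul1n.
Qed.

Lemma diagonal_coef_crossing e : diffop e ->
  (forall a, (0 < a)%N -> diagonal_coef e a 1 = 0) ->
  ~ (forall a, (0 < a)%N -> diagonal_coef e a (n * a).-1 = (n * a).-1%:R).
Proof.
move=> [m em]; apply: (@crossing_facet_lines _ _ m.+1) => // a b ab.
  have := diagonal_coef_line em ab (leq0n n); congr diff_nilpotent.
  by apply/funext => u; rewrite addn0.
have := diagonal_coef_line em ab n_gt0; congr diff_nilpotent.
by apply/funext => u; rewrite mul1n.
Qed.

Lemma supp_in_rnc_sum (T : pred (int * int)) (p : nat) (j x : 'I_p -> rnc K n) :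
  (forall k l, T k -> cone n l -> T (k + l)) ->
  (forall i, supp_in T (rnc_val (j i))) ->
  supp_in T (rnc_val (\sum_i j i * x i)).
Proof.
move=> TD jT; rewrite rnc_val_sum; apply: supp_in_sum => i /=.
exact: supp_inM TD (jT i) (@supp_in_val _ _ n_gt0 _).
Qed.

Lemma facet_operator_not_generated : (3 <= n)%N ->
  ~ ideal_diffop (rnc_P1 K n `&` rnc_P2 K n) facet_operator.
Proof.
move=> n3 [p [j [e [Jj De dE]]]].
pose hi k : K := (2 <= k.2)%R%:R; pose lo k : K := (k.2 < 2)%R%:R.
pose e1 x := \sum_i rscale hi (j i) * e i x.
pose e2 x := \sum_i rscale lo (j i) * e i x.
have e12 x : facet_operator x = e1 x + e2 x.
  rewrite dE -big_split; apply: eq_bigr => i _ /=.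
  rewrite -mulrDl; congr (_ * _); apply: rnc_val_inj; apply/malgP => k.
  rewrite /= mcoeffD !lcoef_lscale -mulrDl /hi /lo.
  by case: leP; rewrite ?addr0 ?add0r mul1r.
have e1T x : supp_in (fun k => 2 <= k.2) (rnc_val (e1 x)).
  apply: supp_in_rnc_sum => [k l k2 /andP[l2 _]|i k] /=; first by lia.
  by rewrite lcoef_lscale mulf_eq0 negb_or /hi; case: (2 <= k.2); rewrite ?eqxx.
have strip_facet2 k : interior n k -> k.2 < 2 -> 2 <= facet2 n k.
  rewrite /interior => /andP[k2 fk] k2'; have {k2 k2'} k21 : k.2 = 1 by lia.
  by rewrite /facet2 k21 in fk *; case: k.1 fk => [[|c]|c] fk; nia.
have e2T x : supp_in (fun k => 2 <= facet2 n k) (rnc_val (e2 x)).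
  apply: supp_in_rnc_sum => [k l k2 /andP[_ l2]|i k] /=.
    by rewrite facet2D; lia.
  rewrite lcoef_lscale mulf_eq0 negb_or => /andP[lok jk].
  apply: strip_facet2; first exact: (facet_idealsI n_gt0 (j i)).1 (Jj i) k jk.
  by apply: contraNT lok => /negPf; rewrite /lo => ->.
have notin (g : rnc K n) (T : pred (int * int)) k :
    supp_in T (rnc_val g) -> ~~ T k -> (rnc_val g)@_k = 0.
  by move=> gT nTk; apply/eqP; apply: contraNT nTk => /gT.
have coneE a b : (b <= n * a)%N ->
    diagonal_coef facet_operator a b = b%:R * (facet2 n (a%:Z, b%:Z))%:~R.
  move=> ab; rewrite /diagonal_coef lcoef_facet_operator.
  by rewrite val_rmon ?cone_nat // lcoefUU mulr1.
apply: (@diagonal_coef_crossing e1).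
- exact: diffop_sum.
- by move=> a a0; apply: notin (e1T _) _.
- move=> a a0; have na : (0 < n * a)%N by rewrite muln_gt0 n_gt0.
  have f1 : facet2 n (a%:Z, (n * a).-1%:Z) = 1 by rewrite /facet2 /=; lia.
  have := coneE a (n * a).-1 (leq_pred _); rewrite f1 mulr1 => <-.
  rewrite /diagonal_coef e12 /= mcoeffD.
  rewrite [X in _ = _ + X](notin _ _ _ (e2T _)) ?addr0 //.
  by rewrite f1.
Qed.

End FacetOperator.

Theorem mainTheorem1 (R : realType) (n : nat) (n_ge1 : (1 <= n)%N) :
  let J : set (rnc R[i] n) := rnc_P1 R[i] n `&` rnc_P2 R[i] n in
  [/\ (1 < n)%N -> J = ideal_gen (rnc_gens R[i] n 1 n.-1),
      n = 1%N ->
        J = ideal_gen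
              [set f : rnc R[i] n | \val f = laur_s R[i] ^+ 2 * laur_t R[i]],
      n = 1%N \/ n = 2%N -> ideal_diffop J = diffop_into J
    & (3 <= n)%N -> ideal_diffop J <> diffop_into J].
Proof.
move=> J; split=> [n1|n1|n12|n3 JE].
- exact: facet_idealsI_gens.
- exact: facet_idealsI_n1.
- by apply: ideal_diffop_rnc_le2 => //; case: n12 => ->.
- apply: (@facet_operator_not_generated R[i] n n_ge1 n3); rewrite -/J JE.
  exact: facet_operator_into.
Qed.
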